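(* Let $p$ be a prime number and $n$ an integer with $1\le n\le p$. Then the number $|\mathcal{P}(\mathbb{Z}_{p^n}[\alpha])|$ of polynomial permutations on $\mathbb{Z}_{p^n}[\alpha]$ is given by \[ |\mathcal{P}(\mathbb{Z}_{p^n}[\alpha])|= \begin{cases} p!\,(p-1)^p\,p^{(n^2+2n-2)p} & \text{if } n<p,\\ p!\,(p-1)^p\,p^{(n^2+2n-3)p} & \text{if } n=p. \end{cases} \]
   Context: $\mathbb{Z}_m=\mathbb{Z}/m\mathbb{Z}$. For a commutative ring $R$ with $1$, the ring of dual numbers over $R$ is $R[\alpha]=R[x]/(x^2)$, where $\alpha=x+(x^2)$; so every element is uniquely $a+b\alpha$ with $a,b\in R$, and $\alpha^2=0$. For a finite commutative ring $A$, a polynomial function on $A$ is a function $A\to A$ of the form $a\mapsto f(a)$ for some $f\in A[x]$; a polynomial permutation of $A$ is a bijective polynomial function on $A$; $\mathcal{P}(A)$ denotes the set (group) of polynomial permutations of $A$. *)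

(* Defs.v *)
From HB Require Import structures.
From mathcomp Require Import all_boot all_order all_fingroup all_algebra.
From mathcomp Require Import boolp.

Set Implicit Arguments.
Unset Strict Implicit.
Unset Printing Implicit Defensive.

Import GRing.Theory.
Local Open Scope ring_scope.

(* [{poly %/ h}] silently replaces [h] by ['X] unless [h] is monic of positive
   degree; [mk_monic_X2] records that this does not happen here, so [dual R] is
   R[x]/(x^2), with alpha the class ['qX] of x. *)
Definition dual (R : comNzRingType) : Type := {poly %/ ('X^2 : {poly R})}.

Lemma mk_monic_X2 (R : nzRingType) : mk_monic ('X^2 : {poly R}) = 'X^2.
Proof. by rewrite /mk_monic size_polyXn monicXn. Qed.

HB.instance Definition _ (R : comNzRingType) :=
  GRing.ComNzRing.copy (dual R) {poly %/ ('X^2 : {poly R})}.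
HB.instance Definition _ (R : finComNzRingType) :=
  Finite.copy (dual R) {poly %/ ('X^2 : {poly R})}.

Definition is_poly_fun (A : comNzRingType) (g : A -> A) : Prop :=
  exists f : {poly A}, forall a : A, g a = f.[a].

Definition poly_perms (A : finComNzRingType) : {set {perm A}} :=
  [set s : {perm A} | `[< is_poly_fun s >]].

(* Main.v *)
(* Write R = Z_(p^n). A polynomial over R[alpha] is f1 + alpha f2, and it maps
   a + b alpha to f1(a) + (b f1'(a) + f2(a)) alpha; so polynomial permutations
   of R[alpha] are triples of functions (f1, f1', f2) on R with f1 injective and
   f1' unit-valued. On a residue class a + p t, Taylor expansion gives
   f1 = sum_j c_j (p t)^j, and since only the degrees j < n <= p in t survive, a
   Vandermonde argument at t = 0, ..., p - 1 shows that (f1, f1') determines and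
   is determined by c_0 and c_1 modulo p^n and by c_j modulo p^(n+1-j) for
   2 <= j <= n, where j = p gives no condition; likewise f2 amounts to d_j modulo
   p^(n-j) for j < n. Polynomial indicator functions of the residue classes make
   these local data independent. Finally f1 is injective with unit derivative
   iff c_0 modulo p permutes the residues and every c_1 is nonzero modulo p. *)

Require Import Defs.
From mathcomp Require Import all_boot all_order all_fingroup all_algebra all_solvable.
From mathcomp Require Import boolp ring zify.

Set Implicit Arguments.
Unset Strict Implicit.
Unset Printing Implicit Defensive.

Import GRing.Theory.
Local Open Scope ring_scope.

(** * Dual numbers: from permutations of R[alpha] to triples of functions on R *)

Section DualNumbers.

(** [A] is R[alpha] seen only through its coordinates [re] and [im]; the quotient by x^2 enters in
    [card_poly_perms_dualE]. *)
Variables (R : finComUnitRingType) (A : finComNzRingType).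
Variables (iota : {rmorphism R -> A}) (eps : A) (re im : A -> R).

Local Notation mk a b := (iota a + iota b * eps).

Hypothesis eps2 : eps * eps = 0.
Hypothesis re_mk : forall a b, re (mk a b) = a.
Hypothesis im_mk : forall a b, im (mk a b) = b.
Hypothesis mk_re_im : forall y, mk (re y) (im y) = y.

Lemma mk_inj a b c d : mk a b = mk c d -> a = c /\ b = d.
Proof.
by move=> E; move: (congr1 re E) (congr1 im E); rewrite !re_mk !im_mk.
Qed.

Lemma horner_map_mk (f : {poly R}) a b :
  (map_poly iota f).[mk a b] = mk f.[a] (b * f^`().[a]).
Proof.
elim/poly_ind: f => [|f c IHf].
  by rewrite rmorph0 deriv0 !horner0 mulr0 rmorph0 mul0r addr0.
rewrite rmorphD rmorphM /= map_polyX map_polyC /= !hornerMXaddC IHf.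
rewrite derivD derivM derivX derivC addr0 mulr1 !hornerE.
rewrite !(rmorphD, rmorphM) /=; ring: eps2.
Qed.

Lemma horner_mk (f1 f2 : {poly R}) a b :
  (map_poly iota f1 + eps *: map_poly iota f2).[mk a b]
  = mk f1.[a] (b * f1^`().[a] + f2.[a]).
Proof.
rewrite hornerD hornerZ !horner_map_mk !(rmorphD, rmorphM) /=.
ring: eps2.
Qed.

Lemma poly_dual_split (f : {poly A}) :
  exists f1 f2, f = map_poly iota f1 + eps *: map_poly iota f2.
Proof.
exists (\poly_(i < size f) re f`_i), (\poly_(i < size f) im f`_i).
apply/polyP=> i; rewrite coefD coefZ !coef_map !coef_poly.
case: ltnP => [_|le_f_i]; first by rewrite [eps * _]mulrC mk_re_im.
by rewrite nth_default // !raddf0 mulr0 addr0.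
Qed.

Definition poly_perm_triples : {set {ffun R -> R} * {ffun R -> R} * {ffun R -> R}} :=
  [set t : {ffun R -> R} * {ffun R -> R} * {ffun R -> R} | `[< exists f1 f2 : {poly R},
     [/\ forall x, t.1.1 x = f1.[x], forall x, t.1.2 x = f1^`().[x],
         forall x, t.2 x = f2.[x], injective (horner f1)
       & forall x, f1^`().[x] \is a GRing.unit] >]].

(** Over a fixed a, [F] acts on b by an affine map of slope [g1 a]; on a finite ring such a map is
    injective iff its slope is a unit. *)
Lemma inj_dualP (F : A -> A) (g0 g1 g2 : R -> R) :
    (forall a b, F (mk a b) = mk (g0 a) (b * g1 a + g2 a)) ->
  injective F <-> injective g0 /\ (forall x, g1 x \is a GRing.unit).
Proof.
move=> FE; split=> [injF | [inj0 unit1]]; last first.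
  move=> y z; rewrite -(mk_re_im y) -(mk_re_im z) !FE => /mk_inj[/inj0 <-].
  by move=> /addIr/(mulIr (unit1 _)) ->.
have unit1 x : g1 x \is a GRing.unit.
  have inj_mul : injective (fun b => b * g1 x).
    move=> b c /= E.
    have /injF/mk_inj[] // : F (mk x b) = F (mk x c) by rewrite !FE E.
  have [h _ hK] := injF_bij inj_mul.
  by apply/unitrP; exists (h 1); have := hK 1; rewrite mulrC => ->.
split=> // x y Exy.
(* These choices kill the alpha-parts of both images, leaving [g0 x] and [g0 y]. *)
pose b := - g2 x / g1 x; pose c := - g2 y / g1 y.
have /injF/mk_inj[] // : F (mk x b) = F (mk y c).
by rewrite !FE Exy !divrK // !addNr.
Qed.

Lemma card_poly_perms_dual : #|poly_perms A| = #|poly_perm_triples|.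
Proof.
(* The value of f1 + alpha f2 at x is f1(x) + f2(x) alpha, and moving to x + alpha adds f1'(x)
   alpha; so two values of [s] recover the triple at x. *)
pose g0 (s : {perm A}) x := re (s (mk x 0)).
pose g2 (s : {perm A}) x := im (s (mk x 0)).
pose g1 (s : {perm A}) x := im (s (mk x 1)) - g2 s x.
pose h s := ([ffun x => g0 s x], [ffun x => g1 s x], [ffun x => g2 s x]).
have hP s : s \in poly_perms A -> exists f1 f2 : {poly R},
   [/\ forall a b, s (mk a b) = mk f1.[a] (b * f1^`().[a] + f2.[a]),
       g0 s =1 horner f1, g1 s =1 horner f1^`() & g2 s =1 horner f2].
  rewrite inE => /asboolP[f]; have [f1 [f2 ->]] := poly_dual_split f => sE.
  have E a b : s (mk a b) = mk f1.[a] (b * f1^`().[a] + f2.[a]).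
    by rewrite sE horner_mk.
  exists f1, f2; split=> // x; rewrite /g0 /g1 /g2 !E ?(re_mk, im_mk) //.
    by rewrite mul1r mul0r add0r addrK.
  by rewrite mul0r add0r.
have h_inj : {in poly_perms A &, injective h}.
  move=> s t /hP[f1 [f2 [sE s0 s1 s2]]] /hP[f1' [f2' [tE t0 t1 t2]]] [].
  move=> /ffunP E0 /ffunP E1 /ffunP E2; apply/permP=> y.
  rewrite -(mk_re_im y) sE tE -s0 -t0 -s1 -t1 -s2 -t2.
  by move: (E0 (re y)) (E1 (re y)) (E2 (re y)); rewrite !ffunE => -> -> ->.
rewrite -(card_in_imset h_inj); apply: eq_card => -[[t0 t1] t2].
apply/imsetP/idP => [[s s_poly]|].
  have [f1 [f2 [sE s0 s1 s2]]] := hP s s_poly; move=> [-> -> ->].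
  rewrite inE; apply/asboolP; exists f1, f2.
  have [|? ?] := (inj_dualP sE).1; first exact: perm_inj.
  by split=> // x; rewrite ffunE.
rewrite inE => /asboolP[f1 [f2 /= [t0E t1E t2E inj0 unit1]]].
pose f := map_poly iota f1 + eps *: map_poly iota f2.
have f_inj : injective (horner f).
  by apply/(inj_dualP (horner_mk f1 f2)).
have sE a b : perm f_inj (mk a b) = mk f1.[a] (b * f1^`().[a] + f2.[a]).
  by rewrite permE horner_mk.
exists (perm f_inj); first by rewrite inE; apply/asboolP; exists f => a; rewrite permE.
congr (_, _, _); apply/ffunP => x; rewrite ffunE /g0 /g1 /g2 !sE ?(re_mk, im_mk) //.
  by rewrite mul1r mul0r add0r addrK.
by rewrite mul0r add0r.
Qed.

End DualNumbers.

Lemma card_poly_perms_dualE (R : finComUnitRingType) :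
  #|poly_perms (dual R)| = #|poly_perm_triples R|.
Proof.
pose h : {poly R} := 'X^2.
have hE : mk_monic h = 'X^2 := mk_monic_X2 R.
have szh (p : {poly R}) : (size p <= 2)%N -> in_qpoly h p = p :> {poly R}.
  by move=> szp; apply: in_qpoly_small; rewrite hE size_polyXn.
pose iota : {rmorphism R -> dual R} := qpolyC h.
pose eps : dual R := in_qpoly h 'X.
have szy (y : dual R) : (size (y : {poly R}) <= 2)%N.
  have sz3 : size (mk_monic h) = 3%N by rewrite hE size_polyXn.
  by rewrite -ltnS -sz3; apply: size_mk_monic.
have mkE a b : iota a + iota b * eps = in_qpoly h (a%:P + b *: 'X).
  have inC c : iota c = in_qpoly h c%:P.
    by apply/val_inj; rewrite [RHS]szh // size_polyC; case: eqP.
  by rewrite in_qpolyD -mul_polyC in_qpolyM !inC.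
have szab (a b : R) : (size (a%:P + b *: 'X)%R <= 2)%N.
  apply: leq_trans (size_polyD _ _) _; rewrite geq_max size_polyC.
  rewrite (leq_trans (size_scale_leq _ _)) ?size_polyX // andbT.
  by case: eqP.
apply: (@card_poly_perms_dual _ _ iota eps (fun y => (y : {poly R})`_0)
  (fun y => (y : {poly R})`_1)) => [|a b|a b|y].
- rewrite -in_qpolyM; apply/val_inj=> /=.
  by rewrite -expr2 hE Pdiv.RingMonic.rmodpp ?monicXn.
- by rewrite mkE szh // !coefE /= mulr0 addr0.
- by rewrite mkE szh // !coefE /= mulr1 add0r.
rewrite mkE; apply/val_inj; rewrite [LHS]szh //.
apply/polyP => -[|[|i]]; rewrite !coefE /= ?(mulr0, mulr1) ?(addr0, add0r) //.
by rewrite nth_default // (leq_trans (szy y)).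
Qed.

(** * Taylor expansion and counting tools *)

Lemma horner_taylor1 (S : comNzRingType) (f : {poly S}) x h :
  exists w, f.[x + h] = f.[x] + h * w.
Proof.
elim/poly_ind: f => [|f c [w IHf]]; first by exists 0; rewrite !horner0; ring.
by exists (w * (x + h) + f.[x]); rewrite !hornerMXaddC IHf; ring.
Qed.

Lemma horner_taylor2 (S : comNzRingType) (f : {poly S}) x h :
  exists w, f.[x + h] = f.[x] + h * f^`().[x] + h ^+ 2 * w.
Proof.
elim/poly_ind: f => [|f c [w IHf]].
  by exists 0; rewrite deriv0 !horner0; ring.
exists (w * (x + h) + f^`().[x]).
rewrite derivD derivM derivX derivC addr0 mulr1 !hornerMXaddC IHf.
by rewrite hornerD hornerMX; ring.
Qed.

Lemma sum_subn_ord m : (2 * \sum_(j < m) (m - j) = m * m.+1)%N.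
Proof.
elim: m => [|m IHm]; first by rewrite big_ord0.
by rewrite big_ord_recl mulnDr subn0 IHm; lia.
Qed.

Lemma card_dffun_expn (I : finType) (p : nat) (e : I -> nat) :
  #|{dffun forall i : I, 'I_(p ^ e i)}| = (p ^ \sum_i e i)%N.
Proof.
rewrite card_dep_ffun foldrE big_map big_enum /= expn_sum.
by apply: eq_bigr => i _; rewrite card_ord.
Qed.

(** * Residues modulo p and polynomials over Z_(p^n) *)

Section PrimePower.

Variables (p n : nat).
Hypotheses (p_pr : prime p) (n_gt0 : (0 < n)%N) (n_le_p : (n <= p)%N).

Local Notation R := 'Z_(p ^ n).

Local Lemma p_gt0 : (0 < p)%N. Proof. exact: prime_gt0. Qed.
Local Lemma p_gt1 : (1 < p)%N. Proof. exact: prime_gt1. Qed.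

Local Lemma pn_gt1 : (1 < p ^ n)%N.
Proof. by rewrite -(expn0 p) ltn_exp2l // p_gt1. Qed.

Lemma ltn_Zp_expn (x : R) : (x < p ^ n)%N.
Proof. by rewrite -[X in (_ < X)%N](Zp_cast pn_gt1). Qed.

Lemma natr_Zp_inj k l :
  (k < p ^ n)%N -> (l < p ^ n)%N -> k%:R = l%:R :> R -> k = l.
Proof.
move=> lt_k lt_l /(congr1 (@nat_of_ord _)); rewrite !val_Zp_nat ?pn_gt1 //.
by rewrite !modn_small.
Qed.

Lemma expr_p_eq0 j : (n <= j)%N -> p%:R ^+ j = 0 :> R.
Proof.
move=> le_nj; rewrite -(subnK le_nj) exprD -[_ ^+ n]natrX.
by rewrite pchar_Zp ?pn_gt1 // mulr0.
Qed.

Definition res (x : R) : 'I_p := Ordinal (ltn_pmod x p_gt0).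
Definition quo (x : R) : nat := (x %/ p)%N.

Lemma res_quo x : x = (res x)%:R + p%:R * (quo x)%:R.
Proof. by rewrite -natrM -natrD addnC mulnC -divn_eq natr_Zp. Qed.

Lemma sub_res x : x - (res x)%:R = p%:R * (quo x)%:R.
Proof. by rewrite {1}(res_quo x) addrAC subrr add0r. Qed.

Lemma quo_lt x : (quo x < p ^ n.-1)%N.
Proof. by rewrite ltn_divLR ?p_gt0 // -expnSr prednK ?ltn_Zp_expn. Qed.

Lemma res_nat k : res k%:R = (k %% p)%N :> nat.
Proof. by rewrite /= val_Zp_nat ?pn_gt1 // modn_dvdm // dvdn_exp. Qed.

Lemma resDp x w : res (x + p%:R * w) = res x.
Proof.
apply: ord_inj; rewrite -(natr_Zp x) -(natr_Zp w) -natrM -natrD !res_nat.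
by rewrite addnC mulnC modnMDl.
Qed.

Lemma res_ord (a : 'I_p) : res a%:R = a.
Proof. by apply: ord_inj; rewrite res_nat modn_small. Qed.

Lemma res_eqP x y : res x = res y -> exists w, x = y + p%:R * w.
Proof.
move=> E; exists ((quo x)%:R - (quo y)%:R); rewrite {1}(res_quo x) E.
by rewrite {2}(res_quo y); ring.
Qed.

Lemma unit_res (x : R) : (x \is a GRing.unit) = (res x != 0 :> nat).
Proof.
rewrite -{1}(natr_Zp x) unitZpE ?pn_gt1 // coprime_pexpl //.
by rewrite prime_coprime.
Qed.

Lemma unit_nat k : (0 < k < p)%N -> k%:R \is a @GRing.unit R.
Proof. by case/andP=> k0 kp; rewrite unit_res res_nat modn_small // -lt0n. Qed.

(* The points 0, ..., p - 1 have pairwise differences that are units. *)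
Lemma poly_Zp_eq0 (f : {poly R}) :
  (size f <= p)%N -> (forall t, f.[t] = 0) -> f = 0.
Proof.
move=> szf f0; apply: contraTeq szf => nzf; rewrite -ltnNge.
pose rs : seq R := [seq k%:R | k <- iota 0 p].
have uniq_iota m k : (k + m <= p)%N ->
    uniq_roots [seq j%:R : R | j <- iota k m].
  elim: m k => //= m IHm k le_km; rewrite IHm ?addSnnS // andbT all_map.
  apply/allP => l; rewrite mem_iota => /andP[lt_kl lt_l].
  rewrite /= /diff_roots mulrC eqxx -natrB ?(ltnW lt_kl) //= unit_nat //; lia.
have : (size rs < size f)%N; last by rewrite size_map size_iota.
apply: max_ring_poly_roots nzf _ (uniq_iota _ _ _) => //.
by apply/allP => t _; apply/eqP.
Qed.

Lemma horner_pX_eq0 (f : {poly R}) :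
  (forall t, f.[p%:R * t] = 0) <-> (forall j, (j < n)%N -> f`_j * p%:R ^+ j = 0).
Proof.
pose g := \poly_(j < size f) (f`_j * p%:R ^+ j) : {poly R}.
have gE j : g`_j = f`_j * p%:R ^+ j.
  by rewrite coef_poly; case: ltnP => // le; rewrite nth_default // mul0r.
have hg t : g.[t] = f.[p%:R * t].
  rewrite horner_poly horner_coef; apply: eq_bigr => i _.
  by rewrite exprMn mulrA.
split=> [f0 j _|f0 t].
  rewrite -gE (@poly_Zp_eq0 g) ?coef0 // => [|t]; last by rewrite hg.
  apply: leq_trans n_le_p; apply/leq_sizeP => i le_ni.
  by rewrite gE expr_p_eq0 // mulr0.
rewrite -hg; suff -> : g = 0 by rewrite horner0.
apply/polyP => j; rewrite coef0 gE; case: (ltnP j n) => [/f0 //|le_nj].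
by rewrite expr_p_eq0 // mulr0.
Qed.

(* [1 - (x - a) ^+ N] is the indicator function of the residue class of [a]:
   units satisfy [u ^+ N = 1] by Euler, and [p ^+ N = 0]; as [p ^ n] divides
   [N], its derivative is identically zero. *)
Lemma poly_glue (P : 'I_p -> {poly R}) :
  exists f : {poly R}, forall x : R,
    f.[x] = (P (res x)).[x - (res x)%:R] /\
    f^`().[x] = (P (res x))^`().[x - (res x)%:R].
Proof.
pose N := (p ^ n * totient (p ^ n))%N.
pose E (a : 'I_p) : {poly R} := 1 - ('X - a%:R%:P) ^+ N.
have N0 : N%:R = 0 :> R by rewrite natrM pchar_Zp ?pn_gt1 // mul0r.
have le_nN : (n <= N)%N.
  apply: leq_trans (ltnW (ltn_expl n p_gt1)) (leq_pmulr _ _).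
  by rewrite totient_gt0 expn_gt0 p_gt0.
have EE a x : (E a).[x] = (a == res x)%:R.
  rewrite /E !hornerE.
  have [->|ne_a] := eqVneq.
    by rewrite sub_res exprMn expr_p_eq0 // mul0r subr0.
  suff -> : (x - a%:R) ^+ N = 1 by rewrite subrr.
  have: x - a%:R \is a GRing.unit.
    rewrite unit_res; apply: contraNneq ne_a => r0; rewrite eq_sym.
    have [|w xE] := @res_eqP (x - a%:R) 0.
      by apply: ord_inj; rewrite r0 /= mod0n.
    by rewrite -[x](subrK a%:R) xE add0r addrC resDp res_ord.
  rewrite -[x - _]natr_Zp; set k := nat_of_ord (x - _).
  rewrite unitZpE ?pn_gt1 // coprime_sym => /Euler_exp_totient Ek.
  rewrite /N mulnC exprM -natrX -Zp_nat_mod ?pn_gt1 // Ek.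
  by rewrite Zp_nat_mod ?pn_gt1 // expr1n.
have dEE a x : (E a)^`().[x] = 0.
  by rewrite derivB deriv_exp -mulr_natr -polyC_natr N0 mulr0 subr0 derivC horner0.
exists (\sum_a E a * (P a \Po ('X - a%:R%:P))) => x; split.
  rewrite horner_sum (bigD1 (res x)) //= big1 ?addr0 => [|a ne_a].
    by rewrite hornerM EE eqxx mul1r horner_comp !hornerE.
  by rewrite hornerM EE (negPf ne_a) mul0r.
rewrite raddf_sum /= horner_sum (bigD1 (res x)) //= big1 ?addr0 => [|a ne_a].
  rewrite derivM hornerD !hornerM dEE EE eqxx deriv_comp.
  rewrite derivB derivX derivC subr0 mulr1 horner_comp !hornerE.
  by [].
by rewrite derivM hornerD !hornerM dEE EE (negPf ne_a) !mul0r addr0.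
Qed.

(* The number of base-[p] digits of freedom of the [j]-th Taylor coefficient.
   Those of index 0 and 1 lose one digit to the residue data; the [j]-th one
   only matters modulo [p ^ (n - j + 1)] through [j * c_j * p ^ (j - 1)], and
   not at all when the factor [j] is itself [p]. *)
Definition expC (j : nat) : nat :=
  (if j <= 1 then n.-1 else if j == p then 0 else n.+1 - j)%N.

Definition code : finType :=
  ('S_p * {ffun 'I_p -> 'I_p.-1}
   * {ffun 'I_p -> {dffun forall j : 'I_n.+1, 'I_(p ^ expC j)}}
   * {ffun 'I_p -> {dffun forall j : 'I_n, 'I_(p ^ (n - j))}})%type.

Definition coefC (k : code) (a : 'I_p) (j : 'I_n.+1) : nat :=
  (if j == 0 :> nat then k.1.1.1 a + p * k.1.2 a j
   else if j == 1 :> nat then (k.1.1.2 a).+1 + p * k.1.2 a j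
   else k.1.2 a j)%N.

Definition code_poly1 (k : code) (a : 'I_p) : {poly R} :=
  \poly_(j < n.+1) (coefC k a (inord j))%:R.

Definition code_poly2 (k : code) (a : 'I_p) : {poly R} :=
  \sum_(j < n) (k.2 a j : nat)%:R *: 'X^j.

(** Polynomial only on each residue class; [poly_glue] supplies the global polynomials. *)
Definition triple_of (k : code) :
    {ffun R -> R} * {ffun R -> R} * {ffun R -> R} :=
  ([ffun x => (code_poly1 k (res x)).[x - (res x)%:R]],
   [ffun x => (code_poly1 k (res x))^`().[x - (res x)%:R]],
   [ffun x => (code_poly2 k (res x)).[x - (res x)%:R]]).

Lemma coef_code_poly1 k a (j : 'I_n.+1) : (code_poly1 k a)`_j = (coefC k a j)%:R.
Proof. by rewrite coef_poly ltn_ord inord_val. Qed.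

Lemma coef_code_poly2 k a (j : 'I_n) : (code_poly2 k a)`_j = (k.2 a j : nat)%:R.
Proof.
rewrite coef_sum (bigD1 j) //= coefZ coefXn eqxx mulr1 big1 ?addr0 // => i ne_ij.
by rewrite coefZ coefXn eq_sym val_eqE (negPf ne_ij) mulr0.
Qed.

Lemma code_poly1_0 k a :
  (code_poly1 k a).[0] = (k.1.1.1 a)%:R + p%:R * (k.1.2 a ord0 : nat)%:R.
Proof.
by rewrite horner_coef0 (coef_code_poly1 k a ord0) /coefC /= natrD natrM.
Qed.

Lemma code_poly1_1 k a :
  exists w, (code_poly1 k a)^`().[0] = (k.1.1.2 a).+1%:R + p%:R * w.
Proof.
have lt1 : (1 < n.+1)%N by [].
exists (k.1.2 a (Ordinal lt1) : nat)%:R.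
rewrite horner_coef0 coef_deriv mulr1n (coef_code_poly1 k a (Ordinal lt1)).
by rewrite /coefC /= natrD natrM.
Qed.

Lemma ltn_pred_S (u : 'I_p.-1) : (u.+1 < p)%N.
Proof. by rewrite -[X in (_ < X)%N](prednK p_gt0) ltnS. Qed.

Lemma triple_of_in k : triple_of k \in poly_perm_triples R.
Proof.
have [f1 f1P] := poly_glue (code_poly1 k); have [f2 f2P] := poly_glue (code_poly2 k).
have res_f1 x : res f1.[x] = k.1.1.1 (res x).
  rewrite (f1P x).1 sub_res -[_ * _]add0r.
  have [w ->] := horner_taylor1 (code_poly1 k (res x)) 0 (p%:R * (quo x)%:R).
  by rewrite -mulrA resDp code_poly1_0 resDp res_ord.
have unit_f1 x : f1^`().[x] \is a GRing.unit.
  rewrite (f1P x).2 sub_res -[_ * _]add0r.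
  have [w ->] := horner_taylor1 (code_poly1 k (res x))^`() 0 (p%:R * (quo x)%:R).
  have [v ->] := code_poly1_1 k (res x).
  rewrite unit_res -mulrA !resDp -unit_res unit_nat //=; exact: ltn_pred_S.
rewrite inE; apply/asboolP; exists f1, f2; split=> //= [x|x|x|x y Exy].
- by rewrite ffunE (f1P x).1.
- by rewrite ffunE (f1P x).2.
- by rewrite ffunE (f2P x).1.
have [w xE] : exists w, x = y + p%:R * w.
  by apply: res_eqP; apply: (@perm_inj _ k.1.1.1); rewrite -!res_f1 Exy.
(* Inside a class, f1(y + p w) - f1(y) = p w (f1'(y) + p w v), and the last factor is a unit because
   its residue is that of f1'(y). *)
have [v] := horner_taylor2 f1 y (p%:R * w).
rewrite -xE Exy -addrA -[LHS]addr0 => /addrI/esym E.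
have u : f1^`().[y] + p%:R * (w * v) \is a GRing.unit.
  by rewrite unit_res resDp -unit_res.
suff w0 : p%:R * w = 0 by rewrite xE w0 addr0.
rewrite -(mulrK u (p%:R * w)) -[RHS](mul0r (f1^`().[y] + p%:R * (w * v))^-1).
by rewrite -E; congr (_ / _); ring.
Qed.

Lemma triple_of_at k (a : 'I_p) (t : R) (x := a%:R + p%:R * t) :
  [/\ (triple_of k).1.1 x = (code_poly1 k a).[p%:R * t],
      (triple_of k).1.2 x = (code_poly1 k a)^`().[p%:R * t]
    & (triple_of k).2 x = (code_poly2 k a).[p%:R * t]].
Proof.
have xa : x - a%:R = p%:R * t by rewrite /x; ring.
by split; rewrite ffunE resDp res_ord xa.
Qed.

(** Equal triples make the differences of local polynomials, and of their derivatives, vanish on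
    multiples of p; [horner_pX_eq0] turns this into congruences between coefficients, and the bounds
    on the digits turn those into equalities. *)
Lemma triple_of_inj : injective triple_of.
Proof.
move=> k k' E.
have D1 a j : (j < n)%N -> (code_poly1 k a - code_poly1 k' a)`_j * p%:R ^+ j = 0.
  move: j; apply/horner_pX_eq0 => t; rewrite hornerD hornerN.
  have [<- _ _] := triple_of_at k a t; have [<- _ _] := triple_of_at k' a t.
  by rewrite E subrr.
have D2 a j : (j < n)%N ->
    (code_poly1 k a - code_poly1 k' a)`_j.+1 * j.+1%:R * p%:R ^+ j = 0.
  rewrite mulr_natr -coef_deriv.
  move: j; apply/horner_pX_eq0 => t; rewrite derivB hornerD hornerN.
  have [_ <- _] := triple_of_at k a t; have [_ <- _] := triple_of_at k' a t.
  by rewrite E subrr.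
have D3 a j : (j < n)%N -> (code_poly2 k a - code_poly2 k' a)`_j * p%:R ^+ j = 0.
  move: j; apply/horner_pX_eq0 => t; rewrite hornerD hornerN.
  have [_ _ <-] := triple_of_at k a t; have [_ _ <-] := triple_of_at k' a t.
  by rewrite E subrr.
have cancel_pX x y j e : (e = n - j)%N -> (j <= n)%N -> (x < p ^ e)%N -> (y < p ^ e)%N ->
    (x%:R - y%:R) * p%:R ^+ j = 0 :> R -> x = y.
  move=> -> le_jn lt_x lt_y /eqP; rewrite mulrBl subr_eq0 -!natrX -!natrM => /eqP eq_xy.
  have lt_pn z : (z < p ^ (n - j))%N -> (z * p ^ j < p ^ n)%N.
    by rewrite -{2}(subnK le_jn) expnD ltn_pmul2r // expn_gt0 p_gt0.
  apply/eqP; rewrite -(@eqn_pmul2r (p ^ j)) ?expn_gt0 ?p_gt0 //; apply/eqP.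
  exact: natr_Zp_inj (lt_pn _ lt_x) (lt_pn _ lt_y) eq_xy.
have digits s x s' x' : (s < p)%N -> (s' < p)%N ->
    (x < p ^ n.-1)%N -> (x' < p ^ n.-1)%N ->
    (s + p * x)%:R - (s' + p * x')%:R = 0 :> R -> s = s' /\ x = x'.
  move=> lt_s lt_s' lt_x lt_x' /eqP; rewrite subr_eq0 => /eqP eq_xy.
  have lt_pn r y : (r < p)%N -> (y < p ^ n.-1)%N -> (r + p * y < p ^ n)%N.
    move=> lt_r lt_y; rewrite -[X in (p ^ X)%N](prednK n_gt0) expnS.
    by rewrite (@leq_trans (p * y.+1)) ?leq_mul // mulnS ltn_add2r.
  have := natr_Zp_inj (lt_pn _ _ lt_s lt_x) (lt_pn _ _ lt_s' lt_x') eq_xy.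
  rewrite ![(p * _)%N]mulnC ![(_ + _ * p)%N]addnC => F; split.
    by move/(congr1 (modn^~ p)): F; rewrite !modnMDl !modn_small.
  by move/(congr1 (divn^~ p)): F; rewrite !divnMDl ?p_gt0 // !divn_small // !addn0.
have EC a (j : 'I_n.+1) : (coefC k a j)%:R - (coefC k' a j)%:R =
    (code_poly1 k a - code_poly1 k' a)`_j by rewrite coefB !coef_code_poly1.
have EC0 a : k.1.1.1 a = k'.1.1.1 a /\ k.1.2 a ord0 = k'.1.2 a ord0.
  have := D1 a 0%N n_gt0; rewrite expr0 mulr1 -(EC a ord0) => /digits.
  by case=> [||||/ord_inj-> /ord_inj->] //; exact: ltn_ord.
have EC1 a (j : 'I_n.+1) : j = 1%N :> nat ->
  k.1.1.2 a = k'.1.1.2 a /\ k.1.2 a j = k'.1.2 a j.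
  move=> j1; have := D2 a 0%N n_gt0; rewrite expr0 !mulr1 -j1 -EC /coefC.
  have -> : (j == 0 :> nat) = false by rewrite j1.
  have -> : (j == 1 :> nat) = true by rewrite j1.
  have lt_x (x : 'I_(p ^ expC j)) : (x < p ^ n.-1)%N.
    by apply: leq_trans (ltn_ord x) _; rewrite /expC j1.
  move/(digits _ _ _ _ (ltn_pred_S _) (ltn_pred_S _) (lt_x _) (lt_x _)).
  by case=> /succn_inj/ord_inj-> /ord_inj->.
have ECj a (j : 'I_n.+1) : k.1.2 a j = k'.1.2 a j.
  have [|lt1j|j1] := ltngtP j 1; last by case: (EC1 a j j1).
    rewrite ltnS leqn0 => /eqP j0; have -> : j = ord0 by exact: ord_inj.
    by case: (EC0 a).
  have expCj : expC j = (if j == p :> nat then 0 else n.+1 - j)%N.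
    by rewrite /expC leqNgt lt1j.
  (* For j = p the digit lies in a one-element type. *)
  apply: ord_inj; have [jp|ne_jp] := eqVneq (j : nat) p.
    have x0 (x : 'I_(p ^ expC j)) : x = 0%N :> nat.
      apply/eqP; rewrite -leqn0 -ltnS; apply: leq_trans (ltn_ord x) _.
      by rewrite expCj jp eqxx.
    by rewrite !x0.
  have lt_x (x : 'I_(p ^ expC j)) : (x < p ^ (n.+1 - j))%N.
    by apply: leq_trans (ltn_ord x) _; rewrite expCj (negPf ne_jp).
  have lt_jn : (j.-1 < n)%N by have := ltn_ord j; lia.
  (* Here 1 < j < p, so the factor j from the derivative is a unit; cancelling it fixes c_j modulo
     p^(n+1-j), one digit more than [D1] gives. *)
  have := D2 a _ lt_jn; rewrite prednK ?(ltnW lt1j) // -EC /coefC.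
  rewrite !gtn_eqF ?(ltnW lt1j) // mulrAC => /eqP.
  rewrite mulIr_eq0 => [/eqP|]; last first.
    by apply/mulIr/unit_nat; have := ltn_ord j; lia.
  by apply: cancel_pX (lt_x _) (lt_x _) => //; have := ltn_ord j; lia.
have ED a (j : 'I_n) : k.2 a j = k'.2 a j.
  apply: ord_inj; have := D3 a j (ltn_ord j); rewrite coefB !coef_code_poly2.
  by apply: cancel_pX => //; exact: ltnW.
move: EC0 EC1 ECj ED.
case: k {E D1 D2 D3 EC} => [[[s u] x] y].
case: k' => [[[s' u'] x'] y'] /= EC0 EC1 ECj ED.
have lt1 : (1 < n.+1)%N by [].
congr (_, _, _, _).
- by apply/permP => a; case: (EC0 a).
- by apply/ffunP => a; case: (EC1 a (Ordinal lt1)).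
- by apply/ffunP => a; apply/ffunP => j.
by apply/ffunP => a; apply/ffunP => j.
Qed.

(** * Every triple has a code *)

Lemma sub_modn_expn (x : R) e i : (n <= e + i)%N ->
  (x - (x %% p ^ e)%N%:R) * p%:R ^+ i = 0.
Proof.
move=> le_n; rewrite -{1}(natr_Zp x) {1}(divn_eq x (p ^ e)) natrD addrK.
by rewrite natrM natrX -mulrA -exprD expr_p_eq0 // mulr0.
Qed.

Lemma res_horner (f : {poly R}) x : res f.[(res x)%:R] = res f.[x].
Proof.
rewrite {2}(res_quo x); have [w ->] := horner_taylor1 f (res x)%:R (p%:R * (quo x)%:R).
by rewrite -mulrA resDp.
Qed.

Lemma triple_of_surj t : t \in poly_perm_triples R -> exists k, t = triple_of k.
Proof.
case: t => [[t0 t1] t2]; rewrite inE => /asboolP[f1 [f2 /= [t0E t1E t2E inj1 unit1]]].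
(* By finiteness f1 is onto R, hence onto the residues, hence injective on them; [g] is a right
   inverse of the residue map. *)
have s_inj : injective (fun a : 'I_p => res f1.[a%:R]).
  pose g (b : 'I_p) := res (invF inj1 b%:R).
  have gK : cancel g (fun a : 'I_p => res f1.[a%:R]).
    by move=> b; rewrite /g res_horner (f_invF inj1) res_ord.
  exact: bij_inj (bij_can_bij (injF_bij (can_inj gK)) gK).
have u_lt (a : 'I_p) : ((res f1^`().[a%:R]).-1 < p.-1)%N.
  have := unit1 a%:R; rewrite unit_res; move: (res _) => r; have := ltn_ord r; lia.
pose T1 (a : 'I_p) : {poly R} := f1 \Po ('X + a%:R%:P).
pose T2 (a : 'I_p) : {poly R} := f2 \Po ('X + a%:R%:P).
(* Indices 0 and 1 store only the quotient by p, their residues being held by the permutation and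
   the unit digits; the others are Taylor coefficients of f1 at a, truncated. *)
pose xd (a : 'I_p) (j : nat) : nat :=
  (if j == 0 then quo f1.[a%:R] else if j == 1 then quo f1^`().[a%:R]
   else ((T1 a)`_j)%R %% p ^ expC j)%N.
have xd_lt a j : (xd a j < p ^ expC j)%N.
  rewrite /xd; case: eqP => [->|_]; first exact: quo_lt.
  case: eqP => [->|_]; first exact: quo_lt.
  by rewrite ltn_mod expn_gt0 p_gt0.
have yd_lt a j : (((T2 a)`_j)%R %% p ^ (n - j) < p ^ (n - j))%N.
  by rewrite ltn_mod expn_gt0 p_gt0.
pose k : code := (perm s_inj, [ffun a => Ordinal (u_lt a)],
  [ffun a => finfun (fun j : 'I_n.+1 => Ordinal (xd_lt a j))],
  [ffun a => finfun (fun j : 'I_n => Ordinal (yd_lt a j))]).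
have T1_horner a x : (T1 a).[x] = f1.[x + a%:R] by rewrite horner_comp !hornerE.
have T2_horner a x : (T2 a).[x] = f2.[x + a%:R] by rewrite horner_comp !hornerE.
have dT1_horner a x : (T1 a)^`().[x] = f1^`().[x + a%:R].
  rewrite deriv_comp derivD derivX derivC addr0 mulr1 horner_comp.
  by rewrite hornerD hornerX hornerC.
have k1E a (j : 'I_n.+1) : (code_poly1 k a)`_j =
   (if j == 0 :> nat then f1.[a%:R] else if j == 1 :> nat then f1^`().[a%:R]
    else (((T1 a)`_j)%R %% p ^ expC j)%N%:R).
  rewrite coef_code_poly1 /coefC /= !ffunE /= /xd; case: eqP => _.
    by rewrite natrD natrM permE -[RHS]natr_Zp -res_quo natr_Zp.
  case: eqP => _ //; rewrite prednK; first by rewrite natrD natrM -res_quo.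
  by rewrite lt0n -unit_res.
have D0 a : (T1 a - code_poly1 k a)`_0 = 0.
  by rewrite coefB (k1E a ord0) /= -horner_coef0 T1_horner add0r subrr.
have lt1 : (1 < n.+1)%N by [].
have D1 a : (T1 a - code_poly1 k a)`_1 = 0.
  rewrite coefB (k1E a (Ordinal lt1)) /= -[(T1 a)`_1]mulr1n -coef_deriv.
  by rewrite -horner_coef0 dT1_horner add0r subrr.
(* The truncation error is killed by p^i; the values need i = j and the derivative i = j - 1. *)
have Dj a j i : (1 < j <= n)%N -> j != p -> (n <= n.+1 - j + i)%N ->
    (T1 a - code_poly1 k a)`_j * p%:R ^+ i = 0.
  case/andP=> lt1j le_jn ne_jp le_n; have lt_jn : (j < n.+1)%N by [].
  rewrite coefB (k1E a (Ordinal lt_jn)) /= !gtn_eqF ?(ltnW lt1j) //.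
  by rewrite /expC leqNgt lt1j (negPf ne_jp) /= sub_modn_expn.
have E0 a t : (T1 a).[p%:R * t] = (code_poly1 k a).[p%:R * t].
  apply/eqP; rewrite -subr_eq0 -hornerN -hornerD; apply/eqP; move: t.
  apply/horner_pX_eq0 => -[|[|j]] lt_jn; rewrite ?(D0, D1) ?mul0r //.
  by apply: Dj; lia.
have E1 a t : (T1 a)^`().[p%:R * t] = (code_poly1 k a)^`().[p%:R * t].
  apply/eqP; rewrite -subr_eq0 -hornerN -hornerD -derivB; apply/eqP; move: t.
  apply/horner_pX_eq0 => -[|j] lt_jn; first by rewrite coef_deriv D1 mul0rn mul0r.
  rewrite coef_deriv -[_ *+ _.+2]mulr_natr mulrAC.
  (* If j + 2 = p, the derivative factor p completes p^(j+1) to p^p, which is 0 since n <= p. *)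
  have [jp|ne_jp] := eqVneq j.+2 p; last by rewrite Dj ?mul0r //; lia.
  by rewrite jp -mulrA -exprSr jp expr_p_eq0 // mulr0.
have E2 a t : (T2 a).[p%:R * t] = (code_poly2 k a).[p%:R * t].
  apply/eqP; rewrite -subr_eq0 -hornerN -hornerD; apply/eqP; move: t.
  apply/horner_pX_eq0 => j lt_jn; rewrite coefB.
  rewrite (coef_code_poly2 k a (Ordinal lt_jn)) !ffunE /=.
  by rewrite sub_modn_expn // subnK // ltnW.
exists k; congr (_, _, _); apply/ffunP => x; rewrite [RHS]ffunE.
- by rewrite t0E sub_res -E0 T1_horner addrC -res_quo.
- by rewrite t1E sub_res -E1 dT1_horner addrC -res_quo.
by rewrite t2E sub_res -E2 T2_horner addrC -res_quo.
Qed.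

(** * Counting the codes *)

(** Index j = p occurs only for n = p, where [expC] is 0 instead of n + 1 - p = 1. The term
    [(n == p)] restores this digit, the source of the two cases of the theorem. *)
Lemma sum_expC :
  (\sum_(j < n.+1) expC j + (n == p) = n.-1 + n.-1 + \sum_(j < n.-1) (n.-1 - j))%N.
Proof.
have sum2l m (F : nat -> nat) : (0 < m)%N ->
    (\sum_(j < m.+1) F j = F 0 + F 1 + \sum_(j < m.-1) F j.+2)%N.
  by case: m => // m _; rewrite 2!big_ord_recl addnA.
have sum1r m (F : nat -> nat) : (0 < m)%N ->
    (\sum_(j < m) F j = \sum_(j < m.-1) F j + F m.-1)%N.
  by case: m => // m _; rewrite big_ord_recr.
rewrite sum2l // {1 2}/expC /= -addnA; congr (_ + _)%N.
have expC_small (j : nat) : (j.+2 < p)%N -> expC j.+2 = (n.-1 - j)%N.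
  by rewrite /expC /= => lt_jp; rewrite ltn_eqF //; lia.
have [np|ne_np] := eqVneq n p; last first.
  rewrite addn0; apply: eq_bigr => j _; apply: expC_small.
  by have := ltn_ord j; move: n_le_p ne_np; lia.
have n1 : (0 < n.-1)%N by have := p_gt1; lia.
rewrite (sum1r _ (fun j => expC j.+2) n1) (sum1r _ (fun j => n.-1 - j)%N n1).
have -> : expC n.-1.-1.+2 = 0%N by rewrite /expC ifT //; lia.
rewrite addn0; congr (_ + _)%N; last by lia.
by apply: eq_bigr => j _; apply: expC_small; have := ltn_ord j; lia.
Qed.

Lemma card_poly_perm_triples :
  #|poly_perm_triples R| = (p`! * p.-1 ^ p
    * p ^ ((\sum_(j < n.+1) expC j) * p) * p ^ ((\sum_(j < n) (n - j)) * p))%N.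
Proof.
have -> : poly_perm_triples R = triple_of @: [set: code].
  apply/setP=> t; apply/idP/imsetP => [/triple_of_surj[k ->]|[k _ ->]].
    by exists k.
  exact: triple_of_in.
rewrite card_imset ?cardsT; last exact: triple_of_inj.
rewrite !card_prod !card_ffun !card_dffun_expn !card_ord -!expnM.
by rewrite card_Sn.
Qed.

End PrimePower.

Theorem theorem8p10 (p n : nat) (p_pr : prime p) (n_gt0 : (1 <= n)%N)
    (n_le_p : (n <= p)%N) :
  #|poly_perms (dual 'Z_(p ^ n))| =
    (if (n < p)%N then p`! * (p - 1) ^ p * p ^ ((n ^ 2 + 2 * n - 2) * p)
     else p`! * (p - 1) ^ p * p ^ ((n ^ 2 + 2 * n - 3) * p))%N.
Proof.
rewrite card_poly_perms_dualE (card_poly_perm_triples p_pr n_gt0 n_le_p).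
rewrite -mulnA -expnD -mulnDl subn1.
have := sum_expC p_pr n_gt0 n_le_p.
(* For n < p the exponent per residue is 2(n-1) + n(n-1)/2 + n(n+1)/2 = n^2 + 2n - 2; for n = p it
   is one less. *)
have := sum_subn_ord n; have := sum_subn_ord n.-1.
set e := (\sum_(j < n.+1) _)%N; set d := (\sum_(j < n) _)%N; set c := (\sum_(j < _) _)%N.
rewrite expnS expn1 prednK // => Ec Ed Ee.
have [lt_np|le_pn] := ltnP n p; congr (_ * p ^ (_ * p))%N.
  by move: Ee; rewrite ltn_eqF // => Ee; nia.
have E : (n == p) by lia.
by move: Ee; rewrite E => Ee; nia.
Qed.
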